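(* For any $p\in[1,\infty]$, the product space $(\mathbb{U}\times\mathbb{U},\rho\times_p\rho)$ is not $\mathscr{F}$-injective. In particular, it is not isometric to $(\mathbb{U},\rho)$.
   Context: $\mathscr{F}$ is the class of all finite metric spaces. A metric space $(X,d)$ is $\mathscr{F}$-injective if it is non-empty and for all finite metric spaces $(Y,e),(Z,h)$ and all isometric (distance-preserving) embeddings $\phi\colon Y\to Z$, $f\colon Y\to X$ there is an isometric embedding $F\colon Z\to X$ with $F\circ\phi=f$. $(\mathbb{U},\rho)$ denotes the Urysohn universal metric space: the separable complete $\mathscr{F}$-injective metric space, unique up to isometry. For metric spaces $(X,d)$, $(Y,e)$ and $p\in[1,\infty)$, $(d\times_p e)((x,y),(u,v))=(d(x,u)^p+e(y,v)^p)^{1/p}$, and $(d\times_\infty e)((x,y),(u,v))=\max\{d(x,u),e(y,v)\}$. *)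

(* Defs.v *)
From HB Require Import structures.
From mathcomp Require Import all_boot all_order all_algebra.
From mathcomp Require Import interval_inference.
From mathcomp Require Import all_classical all_reals all_analysis.
From mathcomp Require Import ring lra.

Set Implicit Arguments.
Unset Strict Implicit.
Unset Printing Implicit Defensive.

Import Order.TTheory GRing.Theory Num.Theory.
Import numFieldNormedType.Exports.

Local Open Scope classical_set_scope.
Local Open Scope ring_scope.

Section isometries.
Context {R : realType}.

Definition isometric_embedding (X Y : metricType R) (f : X -> Y) : Prop :=
  forall x y, mdist (f x) (f y) = mdist x y.

Definition isometric (X Y : metricType R) : Prop :=
  exists2 f : X -> Y, isometric_embedding f & bijective f.

(* Y, and even Z, may be empty. *)
Definition F_injective (X : metricType R) : Prop :=
  [set: X] !=set0 /\
  forall Y Z : metricType R,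
    finite_set [set: Y] -> finite_set [set: Z] ->
  forall (phi : Y -> Z) (f : Y -> X),
    isometric_embedding phi -> isometric_embedding f ->
  exists2 F : Z -> X, isometric_embedding F & F \o phi = f.

Definition separable (X : metricType R) : Prop :=
  exists2 S : set X, countable S & dense S.

(* The library's [completeType] additionally requires a chosen point. *)
Definition complete_space (X : metricType R) : Prop :=
  forall F : set_system X, ProperFilter F -> cauchy F -> exists x : X, F --> x.

(* These properties determine X up to isometry: "the" Urysohn space is any X
   satisfying them. *)
Definition is_urysohn (X : metricType R) : Prop :=
  [/\ separable X, complete_space X & F_injective X].

End isometries.

Section lp2.
Context {R : realType}.

(* The value at -oo is junk, excluded by the hypothesis 1 <= p below. *)
Definition lp2 (p : \bar R) (a b : R) : R :=
  match p with
  | r%:E => (a `^ r + b `^ r) `^ r^-1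
  | +oo%E => Num.max a b
  | -oo%E => 0
  end.

Lemma lp20 p : (1%:E <= p)%E -> lp2 p 0 0 = 0.
Proof.
case: p => [r| |]//=; last by rewrite maxxx.
rewrite lee_fin => r1; have r0 : r != 0 by lra.
by rewrite !powR0 ?addr0 ?powR0 ?invr_eq0.
Qed.

Lemma lp2_eq0 p a b : (1%:E <= p)%E -> 0 <= a -> 0 <= b ->
  lp2 p a b = 0 -> a = 0 /\ b = 0.
Proof.
case: p => [r| |]//=.
  move=> _ a0 b0 /powR_eq0_eq0/eqP.
  rewrite paddr_eq0 ?powR_ge0// => /andP[/eqP ra /eqP rb].
  by split; [exact: powR_eq0_eq0 ra|exact: powR_eq0_eq0 rb].
move=> _ a0 b0 ab; have : Num.max a b <= 0 by rewrite ab.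
by rewrite ge_max => /andP[a0' b0']; split; apply/eqP; rewrite eq_le ?a0' ?b0'.
Qed.

Lemma lp2_homo p a b a' b' : (1%:E <= p)%E -> 0 <= a -> 0 <= b ->
  a <= a' -> b <= b' -> lp2 p a b <= lp2 p a' b'.
Proof.
case: p => [r| |]; last by [].
  2: by move=> _ _ _ aa bb /=; rewrite ge_max !le_max aa bb orbT.
rewrite lee_fin => r1 a0 b0 aa bb; have r0 : 0 <= r by lra.
have a0' := le_trans a0 aa; have b0' := le_trans b0 bb.
by rewrite ge0_ler_powR ?nnegrE ?invr_ge0 ?addr_ge0 ?powR_ge0// lerD//
  ge0_ler_powR// nnegrE.
Qed.

Let powR_jensen (r s t x y : R) : 1 <= r -> 0 <= s -> 0 <= t -> s + t = 1 ->
  0 <= x -> 0 <= y -> (s * x + t * y) `^ r <= s * x `^ r + t * y `^ r.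
Proof.
move=> r1 s0 t0 st x0 y0.
have s01 : 0 <= s <= 1 by lra.
have [/=s' s'E] : exists s' : {i01 R}, s'%:num = s.
  by exists (Itv01 (andP s01).1 (andP s01).2).
have := @convex_powR R r r1 s' x y; rewrite !inE/= !in_itv/= !andbT.
have tE : unstable.onem s'%:num = t.
  by rewrite /unstable.onem s'E -st addrC addKr.
by rewrite -tE -s'E => /(_ x0 y0); apply.
Qed.

Let divpowR (r u v : R) : 0 <= u -> 0 < v -> u `^ r / v `^ r = (u / v) `^ r.
Proof.
move=> u0 v0; have v0' := ltW v0; rewrite powRM ?invr_ge0//; congr (_ * _).
rewrite -(powR_inv1 (powR_ge0 v r)) -(powR_inv1 v0').
exact: powRAC.
Qed.

Let powR_jensen2 (r A C x y : R) : 1 <= r -> 0 < A -> 0 < C ->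
  0 <= x -> 0 <= y -> (x + y) `^ r <= (A + C) `^ r *
    (A / (A + C) * (x `^ r / A `^ r) + C / (A + C) * (y `^ r / C `^ r)).
Proof.
move=> r1 A0 C0 x0 y0.
have AC0 : 0 < A + C := addr_gt0 A0 C0.
have [xA0 yC0] := (divr_ge0 x0 (ltW A0), divr_ge0 y0 (ltW C0)).
have [sA sC] := (divr_ge0 (ltW A0) (ltW AC0), divr_ge0 (ltW C0) (ltW AC0)).
have [An0 Cn0 ACn0] : [/\ A != 0, C != 0 & A + C != 0].
  by split; exact: lt0r_neq0.
have -> : x + y = (A + C) * (A / (A + C) * (x / A) + C / (A + C) * (y / C)).
  by field; rewrite An0 Cn0 ACn0.
rewrite (powRM _ (ltW AC0)); last exact: addr_ge0 (mulr_ge0 _ _) (mulr_ge0 _ _).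
apply: ler_wpM2l; first exact: powR_ge0.
rewrite (divpowR _ x0 A0) (divpowR _ y0 C0); apply: powR_jensen => //.
by rewrite -mulrDl divff.
Qed.

Let minkowski2 (r A C a b c d : R) : 1 <= r -> 0 < A -> 0 < C ->
  0 <= a -> 0 <= b -> 0 <= c -> 0 <= d ->
  A `^ r = a `^ r + b `^ r -> C `^ r = c `^ r + d `^ r ->
  (a + c) `^ r + (b + d) `^ r <= (A + C) `^ r.
Proof.
move=> r1 A0 C0 a0 b0 c0 d0 AE CE.
have Ar : A `^ r != 0 by rewrite lt0r_neq0 ?powR_gt0.
have Cr : C `^ r != 0 by rewrite lt0r_neq0 ?powR_gt0.
have ACn0 : A + C != 0 by rewrite lt0r_neq0 ?addr_gt0.
apply: le_trans (lerD (powR_jensen2 r1 A0 C0 a0 c0)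
                      (powR_jensen2 r1 A0 C0 b0 d0)) _.
rewrite -mulrDr addrACA -!mulrDr -!mulrDl -AE -CE !divff// !mulr1.
by rewrite -mulrDl divff// mulr1.
Qed.

Lemma lp2_triangle p a b c d : (1%:E <= p)%E ->
  0 <= a -> 0 <= b -> 0 <= c -> 0 <= d ->
  lp2 p (a + c) (b + d) <= lp2 p a b + lp2 p c d.
Proof.
move=> p1 a0 b0 c0 d0.
case: p p1 => [r| |] p1; last by [].
2: by rewrite /= ge_max !lerD// le_max lexx ?orbT.
have r1 : 1 <= r by rewrite -lee_fin.
have r0 : 0 < r := lt_le_trans ltr01 r1.
have lp2K x y : 0 <= x -> 0 <= y -> lp2 r%:E x y `^ r = x `^ r + y `^ r.
  move=> x0 y0; rewrite /lp2 -powRrM mulVf ?lt0r_neq0// powRr1//.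
  exact: addr_ge0 (powR_ge0 _ _) (powR_ge0 _ _).
have lp2_ge0 x y : 0 <= lp2 r%:E x y by exact: powR_ge0.
have [A0|An0] := eqVneq (lp2 r%:E a b) 0.
  by have [-> ->] := lp2_eq0 p1 a0 b0 A0; rewrite lp20// !add0r.
have [C0|Cn0] := eqVneq (lp2 r%:E c d) 0.
  by have [-> ->] := lp2_eq0 p1 c0 d0 C0; rewrite lp20// !addr0.
have A0 : 0 < lp2 r%:E a b by rewrite lt0r An0 lp2_ge0.
have C0 : 0 < lp2 r%:E c d by rewrite lt0r Cn0 lp2_ge0.
have := minkowski2 r1 A0 C0 a0 b0 c0 d0 (lp2K _ _ a0 b0) (lp2K _ _ c0 d0).
move: (lp2 r%:E a b) (lp2 r%:E c d) A0 C0 => A C A0 C0 h; rewrite /lp2.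
have AC0 : 0 <= A + C := ltW (addr_gt0 A0 C0).
have -> : A + C = ((A + C) `^ r) `^ r^-1.
  by rewrite -powRrM mulfV ?lt0r_neq0// powRr1.
apply: ge0_ler_powR h; rewrite ?nnegrE ?powR_ge0 ?invr_ge0 ?(ltW r0)//.
exact: addr_ge0 (powR_ge0 _ _) (powR_ge0 _ _).
Qed.

End lp2.

(* An alias of the product type, since [X * Y] already carries the library's
   pseudometric structure. *)
Definition lp_prod (R : realType) (p : \bar R) (p1 : (1%:E <= p)%E)
  (X Y : Type) : Type := (X * Y)%type.

Section lp_prod_metric.
Context {R : realType} {p : \bar R} (p1 : (1%:E <= p)%E) (X Y : metricType R).

Definition lp_dist (x y : lp_prod p1 X Y) : R :=
  lp2 p (mdist x.1 y.1) (mdist x.2 y.2).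

Let lp_distxx x : lp_dist x x = 0.
Proof. by rewrite /lp_dist !mdistxx lp20. Qed.

Let lp_dist_positivity x y : lp_dist x y = 0 -> x = y.
Proof.
case: x y => [x1 x2] [y1 y2].
move=> /(lp2_eq0 p1 (mdist_ge0 _ _) (mdist_ge0 _ _))[/= h1 h2].
by rewrite (mdist_positivity _ _ h1) (mdist_positivity _ _ h2).
Qed.

Let lp_dist_sym x y : lp_dist x y = lp_dist y x.
Proof. by rewrite /lp_dist (metric_sym x.1) (metric_sym x.2). Qed.

Let lp_dist_triangle y x z : lp_dist x z <= lp_dist x y + lp_dist y z.
Proof.
apply: le_trans (lp2_triangle p1 _ _ _ _); rewrite ?mdist_ge0//.
by apply: lp2_homo; rewrite ?mdist_ge0 ?metric_triangle.
Qed.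

HB.instance Definition _ := Choice.copy (lp_prod p1 X Y) (X * Y)%type.
HB.instance Definition _ := @isMetric.Build R (lp_prod p1 X Y)
  lp_dist lp_distxx lp_dist_positivity lp_dist_sym lp_dist_triangle.

Lemma mdist_lp_prodE (x y : lp_prod p1 X Y) :
  mdist x y = lp2 p (mdist x.1 y.1) (mdist x.2 y.2).
Proof. by []. Qed.

End lp_prod_metric.

(* Main.v *)
(** In an l^p product, p finite, the p-th powers of the distances from one point
    to the vertices of a rectangle [{x0, x1} x {y0, y1}] have equal sums over the
    two diagonals. A unit square has all its distances in [1, 2], so any function
    from its vertices to [1, 2] prescribes the distances to a point added to the
    square; the value 2 at one vertex and 1 at the other three violates the
    diagonal identity, and it is likewise impossible for p = oo. *)
Require Import Defs.
From HB Require Import structures.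
From mathcomp Require Import all_boot all_order all_algebra.
From mathcomp Require Import all_classical all_reals all_analysis.
From mathcomp Require Import lra.

Set Implicit Arguments.
Unset Strict Implicit.
Unset Printing Implicit Defensive.

Import Order.TTheory GRing.Theory Num.Theory.

Local Open Scope classical_set_scope.
Local Open Scope ring_scope.

(** An alias, which records [R] and keeps the 0-1 metric apart from any structure already on [T]. *)
Definition discrete_space (R : realType) (T : Type) : Type := T.

Section discrete_space_metric.
Context {R : realType} (T : choiceType).

Definition discrete_dist (x y : discrete_space R T) : R := ((x : T) != y)%:R.

Let discrete_distxx x : discrete_dist x x = 0.
Proof. by rewrite /discrete_dist eqxx. Qed.

Let discrete_dist_positivity x y : discrete_dist x y = 0 -> x = y.
Proof.
rewrite /discrete_dist; case: eqP => [//|_] /eqP.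
by rewrite oner_eq0.
Qed.

Let discrete_dist_sym x y : discrete_dist x y = discrete_dist y x.
Proof. by rewrite /discrete_dist eq_sym. Qed.

Let discrete_dist_triangle y x z :
  discrete_dist x z <= discrete_dist x y + discrete_dist y z.
Proof.
rewrite /discrete_dist -natrD ler_nat.
by have [->|] := eqVneq x y; [rewrite add0n | case: (_ != z)].
Qed.

HB.instance Definition _ := Choice.copy (discrete_space R T) T.
HB.instance Definition _ := @isMetric.Build R (discrete_space R T)
  discrete_dist discrete_distxx discrete_dist_positivity discrete_dist_sym
  discrete_dist_triangle.

Lemma mdist_discreteE (x y : discrete_space R T) :
  mdist x y = ((x : T) != y)%:R.
Proof. by []. Qed.

End discrete_space_metric.

(** The Katetov functions: the possible distances to a new point. Positivity keeps that point
    distinct from those of [X]. *)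
Definition katetov (R : realType) (X : metricType R) (g : X -> R) : Prop :=
  [/\ forall x, 0 < g x,
      forall x y, g x <= mdist x y + g y &
      forall x y, mdist x y <= g x + g y].

(* The point [None] is added to X, at distance g x from each x : X. *)
Definition katetov_ext (R : realType) (X : metricType R) (g : X -> R)
  (kg : katetov g) : Type := option X.

Section katetov_ext_metric.
Context {R : realType} (X : metricType R) (g : X -> R) (kg : katetov g).

Definition katetov_dist (x y : katetov_ext kg) : R :=
  match x, y with
  | Some x, Some y => mdist x y
  | Some x, None | None, Some x => g x
  | None, None => 0
  end.

Let katetov_distxx x : katetov_dist x x = 0.
Proof. by case: x => [x|//]; exact: mdistxx. Qed.

Let katetov_dist_positivity x y : katetov_dist x y = 0 -> x = y.
Proof.
have [g0 _ _] := kg.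
case: x y => [x|] [y|] //= h.
- by rewrite (mdist_positivity _ _ h).
- by have := g0 x; rewrite h ltxx.
- by have := g0 y; rewrite h ltxx.
Qed.

Let katetov_dist_sym x y : katetov_dist x y = katetov_dist y x.
Proof. by case: x y => [x|] [y|] //=; exact: metric_sym. Qed.

Let katetov_dist_triangle y x z :
  katetov_dist x z <= katetov_dist x y + katetov_dist y z.
Proof.
have [g0 g1 g2] := kg.
case: x y z => [x|] [y|] [z|] //=.
- exact: metric_triangle.
- by rewrite addr0.
- by rewrite addrC (metric_sym y).
- by rewrite addr_ge0// ltW.
- by rewrite add0r.
Qed.

HB.instance Definition _ := Choice.copy (katetov_ext kg) (option X).
HB.instance Definition _ := @isMetric.Build R (katetov_ext kg)
  katetov_dist katetov_distxx katetov_dist_positivity katetov_dist_sym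
  katetov_dist_triangle.

Lemma isometric_embedding_katetov_ext :
  isometric_embedding (Some : X -> katetov_ext kg).
Proof. by []. Qed.

Lemma mdist_katetov_ext (x : X) :
  mdist (None : katetov_ext kg) (Some x : katetov_ext kg) = g x.
Proof. by []. Qed.

End katetov_ext_metric.

Section lp2_extra.
Context {R : realType} (p : \bar R) (p1 : (1%:E <= p)%E).
Implicit Types a b c d : R.

Lemma lp210 : lp2 p 1 0 = 1.
Proof.
case: p p1 => [r| |]//=; last by rewrite max_l.
rewrite lee_fin => r1; have r0 : r != 0 by lra.
by rewrite powR0// addr0 !powR1.
Qed.

Lemma lp201 : lp2 p 0 1 = 1.
Proof.
case: p p1 => [r| |]//=; last by rewrite max_r.
rewrite lee_fin => r1; have r0 : r != 0 by lra.
by rewrite powR0// add0r !powR1.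
Qed.

(** The pair [(a, b)] is dominated by [(1, 0) + (0, 1)], a sum of two vectors of norm 1; this treats
    all [p] at once. *)
Lemma lp2_bool_le2 (a b : bool) : lp2 p a%:R b%:R <= 2.
Proof.
apply: (@le_trans _ _ (lp2 p (1 + 0) (0 + 1))).
  by rewrite addr0 add0r lp2_homo// lern1 leq_b1.
by apply: le_trans (lp2_triangle p1 _ _ _ _) _ => //; rewrite lp210 lp201.
Qed.

Lemma lp2_bool_ge1 (a b : bool) : a || b -> 1 <= lp2 p a%:R b%:R.
Proof.
case: a b => [] [] //= _; rewrite ?lp210 ?lp201//.
by rewrite -[leLHS]lp210 lp2_homo.
Qed.

(** For finite [r], adding r-th powers along the two diagonals would give [2 ^ r + 1 = 1 + 1],
    against [2 <= 2 ^ r]. For the maximum, the two mixed equations already bound [a] and [b] by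
    1. *)
Lemma lp2_rectangle_neq a b c d : 0 <= a -> 0 <= b -> 0 <= c -> 0 <= d ->
  lp2 p a b = 2 -> lp2 p a d = 1 -> lp2 p c b = 1 -> lp2 p c d = 1 -> False.
Proof.
case: p p1 => [r| |]//.
  rewrite lee_fin => r1 a0 b0 c0 d0.
  have lp2E x y t : lp2 r%:E x y = t -> x `^ r + y `^ r = t `^ r.
    move=> <-; rewrite /lp2 -powRrM mulVf ?powRr1 ?addr_ge0 ?powR_ge0//.
    by rewrite gt_eqF//; lra.
  move=> /lp2E ab /lp2E + /lp2E + /lp2E; rewrite !powR1 => ad cb cd.
  have : 2 `^ 1 <= (2 : R) `^ r by rewrite ler_powR// ler1n.
  by rewrite powRr1//; lra.
move=> _ _ _ _ _ /= ab ad cb _.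
have a1 : a <= 1 by rewrite -ad le_max lexx.
have b1 : b <= 1 by rewrite -cb le_max lexx orbT.
have : Num.max a b <= 1 by rewrite ge_max a1 b1.
by rewrite ab; lra.
Qed.

End lp2_extra.

Section lp_square.
Context {R : realType} {p : \bar R} (p1 : (1%:E <= p)%E).

Let square := lp_prod p1 (discrete_space R bool) (discrete_space R bool).

Definition square_dist (y : square) : R := if y.1 || y.2 then 1 else 2.

(** Values in [1, 2] differ by at most 1, a lower bound for the distance of distinct vertices, and
    add up to at least 2, an upper bound for all distances. *)
Lemma katetov_square_dist : katetov square_dist.
Proof.
have g1 y : 1 <= square_dist y by rewrite /square_dist; case: ifP => _; lra.
have g2 y : square_dist y <= 2 by rewrite /square_dist; case: ifP => _; lra.
split=> [y|x y|x y]; first exact: lt_le_trans (g1 y).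
- have [->|xy] := eqVneq x y; first by rewrite mdistxx add0r.
  suff : 1 <= mdist x y by have := g2 x; have := g1 y; lra.
  rewrite mdist_lp_prodE !mdist_discreteE; apply: lp2_bool_ge1 => //.
  by rewrite -negb_and -xpair_eqE -!surjective_pairing.
- have := g1 x; have := g1 y.
  suff : mdist x y <= 2 by lra.
  by rewrite mdist_lp_prodE !mdist_discreteE lp2_bool_le2.
Qed.

End lp_square.

(** Extend the empty map: the discrete space on [void] serves as the empty subspace of [Z]. *)
Lemma F_injective_embedding (R : realType) (X Z : metricType R) :
  F_injective X -> finite_set [set: Z] ->
  exists F : Z -> X, isometric_embedding F.
Proof.
move=> [_ /(_ (discrete_space R void) Z) X_inj] Z_fin.
have void_fin : finite_set [set: discrete_space R void].
  suff -> : [set: discrete_space R void] = set0 by [].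
  by apply/seteqP; split=> [[]|].
have [||F F_iso _] := X_inj void_fin Z_fin (of_void Z) (of_void X); [by case..|].
by exists F.
Qed.

Lemma lp_prod_not_F_injective (R : realType) (p : \bar R) (p1 : (1%:E <= p)%E)
    (X Y : metricType R) :
  F_injective X -> F_injective Y -> ~ F_injective (lp_prod p1 X Y).
Proof.
move=> X_inj Y_inj [_ XY_inj].
have bool_fin : finite_set [set: discrete_space R bool].
  exact: (@finite_finset bool).
(* Each factor contains two points at distance 1, so the product contains a unit square. *)
have [f f_iso] := F_injective_embedding X_inj bool_fin.
have [h h_iso] := F_injective_embedding Y_inj bool_fin.
pose S := lp_prod p1 (discrete_space R bool) (discrete_space R bool).
pose k := katetov_square_dist p1.
pose fh (y : S) : lp_prod p1 X Y := (f y.1, h y.2).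
have fh_iso : isometric_embedding fh.
  by move=> x y; rewrite !mdist_lp_prodE f_iso h_iso.
have [|||F F_iso FE] := XY_inj S (katetov_ext k) _ _ _ fh
  (@isometric_embedding_katetov_ext _ _ _ k).
(* The aliases unfold to plain finite types. *)
- exact: (@finite_finset (bool * bool)%type).
- exact: (@finite_finset (option (bool * bool))%type).
- exact: fh_iso.
(* The point [F None] realizes the prescribed distances to the four vertices [(f i, h j)]. *)
have D (i j : bool) : lp2 p (mdist (F None).1 (f i)) (mdist (F None).2 (h j)) =
    if i || j then 1 else 2.
  have := mdist_katetov_ext k (i, j).
  by rewrite -F_iso mdist_lp_prodE -[F (Some _)]/((F \o Some) _) FE.
exact: (lp2_rectangle_neq p1 (mdist_ge0 _ _) (mdist_ge0 _ _) (mdist_ge0 _ _)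
  (mdist_ge0 _ _) (D false false) (D false true) (D true false) (D true true)).
Qed.

(** Push [f] forward to [Y], extend it there, and pull the extension back along the inverse
    isometry. *)
Lemma isometric_F_injective (R : realType) (X Y : metricType R) :
  isometric X Y -> F_injective Y -> F_injective X.
Proof.
move=> [i i_iso [j ij ji]] [[y _] Y_inj]; split; first by exists (j y).
move=> A B A_fin B_fin phi f phi_iso f_iso.
have if_iso : isometric_embedding (i \o f).
  by move=> a b /=; rewrite i_iso f_iso.
have [F F_iso FE] := Y_inj A B A_fin B_fin phi (i \o f) phi_iso if_iso.
(* The inverse [j] preserves distances because [i] does and [i \o j] is the identity. *)
exists (j \o F) => [a b|]; first by rewrite -i_iso /= !ji F_iso.
apply/funext => a /=.
by rewrite -[F (phi a)]/((F \o phi) a) FE /= ij.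
Qed.

Theorem theorem1p3 (R : realType) (U : metricType R) (hU : is_urysohn U)
    (p : \bar R) (p1 : (1%:E <= p)%E) :
  ~ F_injective (lp_prod p1 U U) /\ ~ isometric (lp_prod p1 U U) U.
Proof.
have [_ _ U_inj] := hU.
have UU_not_inj := @lp_prod_not_F_injective R p p1 U U U_inj U_inj.
by split=> // /isometric_F_injective/(_ U_inj).
Qed.
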